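(* Let $A\in\mathbb{R}^{N\times N}$ be symmetric positive definite with smallest and largest eigenvalues $\lambda_{\min},\lambda_{\max}$, and let $\mathbf{c}\in\mathbb{R}^N$. Let $\check{\mathbf{Q}}_M,\check{\mathbf{T}}_M,\check{\mathbf{T}}_{M+1}$ be the quantities produced by the finite-precision Lanczos process, with $\epsilon_0,\epsilon_1,\epsilon_2$ and the standing properties as in the context, and assume $$\lambda_{\min}>(M+1)^{5/2}\epsilon_2\|A\|_2 .$$ Let $X_M$ be the unique solution of $\check{\mathbf{T}}_MX_M+X_M\check{\mathbf{T}}_M=\|\mathbf{c}\|_2^2\,\mathbf{e}_1\mathbf{e}_1^T$, let $X_{\mathtt{lan}}=\check{\mathbf{Q}}_MX_M\check{\mathbf{Q}}_M^T$, and let $$\boldsymbol{\rho}_M=A\check{\mathbf{Q}}_MX_M\check{\mathbf{Q}}_M^T+\check{\mathbf{Q}}_MX_M\check{\mathbf{Q}}_M^TA-\mathbf{c}\mathbf{c}^T$$ be its residual for the Lyapunov equation $AX+XA=\mathbf{c}\mathbf{c}^T$. Let $\kappa_{M+1}$ and $\widetilde\kappa_{M+1}$ be the ($2$-norm) condition numbers of $\check{\mathbf{T}}_{M+1}$ and of $\check{\mathbf{T}}_{M+1}+\lambda_{\min}(\check{\mathbf{T}}_{M+1})I$, respectively. Then $$\frac{\|\boldsymbol{\rho}_M\|_F}{\|\mathbf{c}\|_2^2}\le C_1\left(\frac{\sqrt{\widetilde\kappa_{M+1}}-1}{\sqrt{\widetilde\kappa_{M+1}}+1}\right)^M+C_2\,\epsilon_1,$$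 with $$C_1=(1+2\epsilon_0)(M+1)\bigl(4+4\sqrt{2\kappa_{M+1}}\bigr),\qquad C_2=\frac{\sqrt{1+2\epsilon_0}\,M\lambda_{\max}}{\lambda_{\min}-M^{5/2}\epsilon_2\|A\|_2}.$$
   Context: Exact Lanczos process: $\beta_0=0$, $\mathbf{q}_0=0$, $\mathbf{q}_1=\mathbf{c}/\|\mathbf{c}\|_2$, and for $j=1,2,\dots$: $\mathbf{w}=A\mathbf{q}_j-\beta_{j-1}\mathbf{q}_{j-1}$, $\alpha_j=\mathbf{q}_j^T\mathbf{w}$, $\mathbf{w}\leftarrow\mathbf{w}-\alpha_j\mathbf{q}_j$, $\beta_j=\|\mathbf{w}\|_2$, $\mathbf{q}_{j+1}=\mathbf{w}/\beta_j$ (no reorthogonalization). It is assumed throughout that $M<N$ and that no breakdown occurs. When it is run in floating-point arithmetic with unit roundoff $\epsilon$, the computed quantities after $M$ iterations are denoted $\check{\mathbf{Q}}_M\in\mathbb{R}^{N\times M}$, $\check{\mathbf{q}}_{M+1}\in\mathbb{R}^N$, $\check\beta_M$, and the symmetric tridiagonal matrix $\check{\mathbf{T}}_M\in\mathbb{R}^{M\times M}$ (diagonal $\check\alpha_1,\dots,\check\alpha_M$, off-diagonal $\check\beta_1,\dots,\check\beta_{M-1}$). $\check{\mathbf{Q}}_{M+1}=[\check{\mathbf{Q}}_M,\check{\mathbf{q}}_{M+1}]$. $\check{\mathbf{T}}_{M+1}$ is the tridiagonal matrix obtained after one additional iteration; $\check{\mathbf{T}}_M$ is its leading principal submatrix and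 $\check\beta_M$ is its last off-diagonal entry. Set $$\epsilon_0=2(N+4)\epsilon,\quad \epsilon_1=2\Bigl(7+s\frac{\||A|\|_2}{\|A\|_2}\Bigr)\epsilon,\quad \epsilon_2=\sqrt2\max\{6\epsilon_0,\epsilon_1\},$$ where $|A|$ is the elementwise absolute value and $s$ the maximum number of nonzeros in any row of $A$. The analysis uses the following known properties of the finite-precision Lanczos process (Paige; valid under mild conditions on $\epsilon_0,\epsilon_1$, which are assumed): (i) $A\check{\mathbf{Q}}_M=\check{\mathbf{Q}}_M\check{\mathbf{T}}_M+\check\beta_M\check{\mathbf{q}}_{M+1}\mathbf{e}_M^T+F_M$ with $\|F_M\|_F\le\sqrt M\,\epsilon_1\|A\|_2$; (ii) the spectrum of $\check{\mathbf{T}}_M$ is contained in $[\lambda_{\min}-M^{5/2}\epsilon_2\|A\|_2,\ \lambda_{\max}+M^{5/2}\epsilon_2\|A\|_2]$, and the same holds with $M$ replaced by $M+1$; (iii) $\|\check{\mathbf{Q}}_M\|_F\le\sqrt{(1+2\epsilon_0)M}$ and $\|\check{\mathbf{Q}}_{M+1}\|_F\le\sqrt{(1+2\epsilon_0)(M+1)}$. Apart from the roundoff described by (i)–(iii), all other computations are assumed exact (such as the solution of projected Lyapunov equations); in particular $\mathbf{c}=\|\mathbf{c}\|_2\check{\mathbf{Q}}_M\mathbf{e}_1$. $\mathbf{e}_j$ denotes the $j$th unit vector of appropriate size. *)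

(* Defs.v *)
From HB Require Import structures.
From mathcomp Require Import all_boot all_order all_algebra.
From mathcomp Require Import all_classical all_reals.
From mathcomp Require Import exp.

Set Implicit Arguments.
Unset Strict Implicit.
Unset Printing Implicit Defensive.

Import Order.TTheory GRing.Theory Num.Theory.

Local Open Scope classical_set_scope.
Local Open Scope ring_scope.

Section Matrices.
Context {R : realType}.

(* The norm that MathComp-Analysis puts on matrices is the entrywise maximum,
   hence the following explicit Euclidean, Frobenius and spectral norms. *)
Definition vnorm2 n (v : 'cV[R]_n) : R := Num.sqrt (\sum_i v i 0 ^+ 2).

Definition normF m n (A : 'M[R]_(m, n)) : R :=
  Num.sqrt (\sum_i \sum_j A i j ^+ 2).

Definition opnorm2 m n (A : 'M[R]_(m, n)) : R :=
  sup [set vnorm2 (A *m x) | x in [set x : 'cV[R]_n | vnorm2 x <= 1]].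

Definition cond2 n (A : 'M[R]_n) : R := opnorm2 A * opnorm2 (invmx A).

(* For a symmetric matrix of size at least 1, the set of eigenvalues is finite
   and nonempty, so these are the smallest and the largest eigenvalue. *)
Definition lambda_min n (A : 'M[R]_n) : R := inf [set mu | eigenvalue A mu].

Definition lambda_max n (A : 'M[R]_n) : R := sup [set mu | eigenvalue A mu].

Definition spd n (A : 'M[R]_n) : Prop :=
  A \is symmetricmx /\
  forall x : 'cV[R]_n, x != 0 -> 0 < (x^T *m A *m x) 0 0.

Definition absmx m n (A : 'M[R]_(m, n)) : 'M[R]_(m, n) :=
  map_mx (fun a => `|a|) A.

Definition max_row_nnz m n (A : 'M[R]_(m, n)) : nat :=
  (\max_(i < m) #|[pred j : 'I_n | A i j != 0%R]|)%N.

(* The index j is 1-based: unitv n 1, ..., unitv n n is the standard basis. *)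
Definition unitv n (j : nat) : 'cV[R]_n := \col_(i < n) (i.+1 == j)%:R.

Definition lyap_residual n (A : 'M[R]_n) (c : 'cV[R]_n) (X : 'M[R]_n) :
    'M[R]_n :=
  A *m X + X *m A - c *m c^T.

End Matrices.

Section FinitePrecisionLanczos.
Context {R : realType}.

(* The Lanczos sequences q_1, q_2, ..., alpha_1, alpha_2, ... and
   beta_1, beta_2, ... are functions on nat whose value at 0 is not used,
   whereas rows and columns of matrices are numbered from 0. *)
Definition lanczosQ N (q : nat -> 'cV[R]_N) (M : nat) : 'M[R]_(N, M) :=
  \matrix_(i < N, j < M) q j.+1 i 0.

Definition lanczosT (alpha beta : nat -> R) (M : nat) : 'M[R]_M :=
  \matrix_(i < M, j < M)
    if i == j :> nat then alpha i.+1
    else if i.+1 == j :> nat then beta i.+1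
    else if j.+1 == i :> nat then beta j.+1
    else 0.

Definition eps0 (N : nat) (eps : R) : R := 2 * (N%:R + 4) * eps.

Definition eps1 N (A : 'M[R]_N) (eps : R) : R :=
  2 * (7 + (max_row_nnz A)%:R * (opnorm2 (absmx A) / opnorm2 A)) * eps.

Definition eps2 N (A : 'M[R]_N) (eps : R) : R :=
  Num.sqrt 2 * Num.max (6 * eps0 N eps) (eps1 A eps).

Definition ritz_slack N (A : 'M[R]_N) (eps : R) (k : nat) : R :=
  k%:R `^ (5 / 2) * eps2 A eps * opnorm2 A.

(* Paige's description of the quantities computed by M + 1 iterations of the
   Lanczos process for A and c in floating-point arithmetic with unit roundoff
   eps; the normalization of the starting vector is exact. *)
Record fp_lanczos N (A : 'M[R]_N) (c : 'cV[R]_N) (eps : R) (M : nat)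
    (q : nat -> 'cV[R]_N) (alpha beta : nat -> R) : Prop := FpLanczos {
  fp_no_breakdown : forall j, (1 <= j <= M)%N -> 0 < beta j;
  fp_start : c = vnorm2 c *: (lanczosQ q M *m unitv M 1);
  fp_recurrence : exists F : 'M[R]_(N, M),
    A *m lanczosQ q M = lanczosQ q M *m lanczosT alpha beta M
      + beta M *: (q M.+1 *m (unitv M M)^T) + F /\
    normF F <= Num.sqrt M%:R * eps1 A eps * opnorm2 A;
  fp_spectrum : forall k, k = M \/ k = M.+1 ->
    forall mu, eigenvalue (lanczosT alpha beta k) mu ->
      lambda_min A - ritz_slack A eps k <= mu
        <= lambda_max A + ritz_slack A eps k;
  fp_basis : forall k, k = M \/ k = M.+1 ->
    normF (lanczosQ q k) <= Num.sqrt ((1 + 2 * eps0 N eps) * k%:R)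
}.

End FinitePrecisionLanczos.

(* Main.v *)
Require Import Defs.
From mathcomp Require Import all_boot all_order all_algebra.
From mathcomp Require Import all_classical all_reals.
From mathcomp Require Import exp.
From mathcomp Require Import zify ring lra.
From mathcomp Require Import complex.

(** Write [T = T_M], [T1 = T_(M+1)] and [Q = Q_M]. After division by
    [||c||^2] the projected equation is [T Y + Y T = e_1 e_1^T], and the
    recurrence [A Q = Q T + beta_M q_(M+1) e_M^T + F] turns the residual into
      [q_(M+1) (beta_M Y e_M)^T Q^T + F Y Q^T] plus its transpose
    ([lyapunov_residual_projected]), because the part [Q (T Y + Y T) Q^T] is
    cancelled by [c c^T]. Frobenius norms of the two terms are estimated
    separately.

    The rounding term needs only [||F||], [||Q||] and
    [||Y|| <= 1 / (2 lambda_min(T))]; the last bound is read off the entries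
    of [Y] in an eigenbasis of [T] ([lyapunov_normF_le]). It gives [C_2].

    In the other term everything reduces to [beta_M Y e_M], a quantity of the
    exact Lanczos process for [T1] started at [e_1]. Expanding [Y] in the
    eigenvectors of [T], with eigenvalues [th_i], the [i]-th coordinate of
    [Y e_M] in that basis is the one of [e_1] times the last entry of
    [y_i = (T + th_i)^-1 e_1] ([lyapunov_mul_le]). Padding [y_i] with a zero
    yields the Galerkin approximation, from the first [M] coordinates, to the
    solution of [(T1 + th_i) x = e_1], with residual [- beta_M (y_i)_M e_(M+1)].
    So [beta_M (y_i)_M] is a residual norm of the conjugate gradient method
    and obeys its Chebyshev bound ([cg_residual_le]). By interlacing
    [th_i >= lambda_min(T1)], hence [T1 + th_i] is at least as well conditioned
    as [T1 + lambda_min(T1)], which gives the rate, while the energy norm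
    costs a factor [sqrt (kappa (T1 + th_i)) <= sqrt (kappa (T1))]
    ([lanczos_lyapunov_last_column]).

    Both condition numbers enter through lower bounds only ([cond2_ge]), as
    the estimate increases with them. The eigenbases come from the real
    spectral theorem [symmetric_spectral]. *)

Import Order.TTheory GRing.Theory Num.Theory.
Local Open Scope ring_scope.

Set Implicit Arguments.
Unset Strict Implicit.

(** * The Frobenius norm *)

Lemma cauchy_schwarz {R : realFieldType} (I : finType) (a b : I -> R) :
  (\sum_i a i * b i) ^+ 2 <= (\sum_i a i ^+ 2) * (\sum_i b i ^+ 2).
Proof.
have : 0 <= \sum_i \sum_j (a i * b j - a j * b i) ^+ 2.
  by apply: sumr_ge0 => i _; apply: sumr_ge0 => j _; exact: sqr_ge0.
have -> : \sum_i \sum_j (a i * b j - a j * b i) ^+ 2 =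
    \sum_i \sum_j a i ^+ 2 * b j ^+ 2 + \sum_i \sum_j b i ^+ 2 * a j ^+ 2
    - 2 * \sum_i \sum_j (a i * b i) * (a j * b j).
  rewrite mulr_sumr -big_split -sumrB; apply: eq_bigr => i _.
  rewrite mulr_sumr -big_split -sumrB; apply: eq_bigr => j _ /=; ring.
rewrite -!big_distrlr /= -expr2; lra.
Qed.

Lemma normF_ge0 {R : realType} m n (A : 'M[R]_(m, n)) : 0 <= normF A.
Proof. exact: sqrtr_ge0. Qed.

Lemma sqr_normF {R : realType} m n (A : 'M[R]_(m, n)) :
  normF A ^+ 2 = \sum_i \sum_j A i j ^+ 2.
Proof.
rewrite sqr_sqrtr //.
by apply: sumr_ge0 => i _; apply: sumr_ge0 => j _; exact: sqr_ge0.
Qed.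

Lemma normF_le {R : realType} m n (A : 'M[R]_(m, n)) (b : R) :
  0 <= b -> \sum_i \sum_j A i j ^+ 2 <= b ^+ 2 -> normF A <= b.
Proof.
by move=> b0 le_b; rewrite -(@ler_pXn2r _ 2) ?nnegrE ?normF_ge0// sqr_normF.
Qed.

Lemma normF_trmx {R : realType} m n (A : 'M[R]_(m, n)) : normF A^T = normF A.
Proof.
rewrite /normF exchange_big; congr Num.sqrt.
by apply: eq_bigr => i _; apply: eq_bigr => j _; rewrite mxE.
Qed.

Lemma normFZ {R : realType} m n (a : R) (A : 'M[R]_(m, n)) :
  normF (a *: A) = `|a| * normF A.
Proof.
rewrite /normF -sqrtr_sqr -sqrtrM ?sqr_ge0// mulr_sumr; congr Num.sqrt.
apply: eq_bigr => i _; rewrite mulr_sumr; apply: eq_bigr => j _.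
by rewrite mxE exprMn.
Qed.

Lemma normFD {R : realType} m n (A B : 'M[R]_(m, n)) :
  normF (A + B) <= normF A + normF B.
Proof.
apply: normF_le; first by rewrite addr_ge0 ?normF_ge0.
have dot_le : \sum_i \sum_j A i j * B i j <= normF A * normF B.
  apply: le_trans (ler_norm _) _.
  rewrite -(@ler_pXn2r _ 2) ?nnegrE ?mulr_ge0 ?normF_ge0//.
  rewrite exprMn !sqr_normF real_normK ?num_real// !pair_bigA /=.
  exact: (cauchy_schwarz (fun p => A p.1 p.2) (fun p => B p.1 p.2)).
have -> : \sum_i \sum_j (A + B) i j ^+ 2 =
    \sum_i \sum_j A i j ^+ 2 + \sum_i \sum_j B i j ^+ 2
    + 2 * \sum_i \sum_j A i j * B i j.
  rewrite mulr_sumr -!big_split; apply: eq_bigr => i _.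
  rewrite mulr_sumr -!big_split; apply: eq_bigr => j _ /=; rewrite mxE; ring.
rewrite -!sqr_normF; nra.
Qed.

Lemma normFM {R : realType} m n p (A : 'M[R]_(m, n)) (B : 'M[R]_(n, p)) :
  normF (A *m B) <= normF A * normF B.
Proof.
apply: normF_le; first by rewrite mulr_ge0 ?normF_ge0.
rewrite exprMn sqr_normF -(normF_trmx B) sqr_normF big_distrlr /=.
apply: ler_sum => i _; apply: ler_sum => j _; rewrite mxE.
apply: le_trans (cauchy_schwarz _ _) _.
by under [X in _ <= _ * X]eq_bigr do rewrite mxE.
Qed.

Lemma sqr_normF_mxtrace {R : realType} m n (A : 'M[R]_(m, n)) :
  normF A ^+ 2 = \tr (A^T *m A).
Proof.
rewrite sqr_normF exchange_big; apply: eq_bigr => j _; rewrite mxE.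
by apply: eq_bigr => i _; rewrite mxE expr2.
Qed.

Lemma normF_orthogonal_mul {R : realType} m n (U : 'M[R]_m)
    (A : 'M[R]_(m, n)) :
  U^T *m U = 1%:M -> normF (U *m A) = normF A.
Proof.
move=> UU; apply/eqP; rewrite -(@eqrXn2 _ 2) ?normF_ge0// !sqr_normF_mxtrace.
by rewrite trmx_mul mulmxA -(mulmxA A^T) UU mulmx1.
Qed.

Lemma normF_mul_orthogonal {R : realType} m n (A : 'M[R]_(m, n))
    (U : 'M[R]_n) :
  U *m U^T = 1%:M -> normF (A *m U) = normF A.
Proof.
move=> UU; rewrite -normF_trmx trmx_mul normF_orthogonal_mul ?trmxK//.
by rewrite normF_trmx.
Qed.

Lemma vnorm2E {R : realType} n (v : 'cV[R]_n) : vnorm2 v = normF v.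
Proof. by congr Num.sqrt; apply: eq_bigr => i _; rewrite big_ord1. Qed.

Lemma normF0 {R : realType} m n : normF (0 : 'M[R]_(m, n)) = 0.
Proof.
rewrite /normF big1 ?sqrtr0// => i _.
by rewrite big1 // => j _; rewrite mxE expr0n.
Qed.

Lemma normF_eq0 {R : realType} m n (A : 'M[R]_(m, n)) :
  (normF A == 0) = (A == 0).
Proof.
apply/eqP/eqP => [nA|->]; last first.
  exact: normF0.
apply/matrixP => i j; rewrite [RHS]mxE; apply/eqP; rewrite -sqrf_eq0.
have := sqr_normF A; rewrite nA expr0n /= pair_bigA => /esym/psumr_eq0P.
by move=> /(_ (fun p _ => sqr_ge0 _))/(_ (i, j) isT) /= ->.
Qed.

Lemma trmx_mul_cV {R : realType} n (v : 'cV[R]_n) :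
  v^T *m v = (normF v ^+ 2)%:M.
Proof. by rewrite [LHS]mx11_scalar sqr_normF_mxtrace /mxtrace big_ord1. Qed.

Lemma normF_delta_cV {R : realType} n (i : 'I_n) :
  normF (delta_mx i 0 : 'cV[R]_n) = 1.
Proof.
rewrite /normF (bigD1 i) //= big_ord1 mxE !eqxx expr1n big1 ?addr0 ?sqrtr1//.
by move=> j ji; rewrite big_ord1 mxE (negPf ji) expr0n.
Qed.

(** * The spectral theorem for real symmetric matrices *)

(** The complexification is Hermitian, so its eigenvalues are real; they are
    roots of the characteristic polynomial, whose coefficients are those of the
    real matrix. *)
Lemma symmetric_has_eigenvalue {R : realType} n (A : 'M[R]_n.+1) :
  A^T = A -> exists mu, eigenvalue A mu.
Proof.
move=> symA; pose AC := map_mx (real_complex R) A.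
have hermAC : AC \is hermitianmx _ false Num.conj.
  apply: realsym_hermsym.
    by rewrite is_hermitianmxE expr0 scale1r map_mx_id // /AC map_trmx symA.
  by apply/mxOverP => i j; rewrite mxE complex_real.
have specAC := orthomx_spectralP (hermitian_normalmx hermAC).
have /mxOverP/(_ 0 0)/complex_realP[mu dmu] :=
  hermitian_spectral_diag_real hermAC.
exists mu; rewrite eigenvalue_root_char -(fmorph_root (real_complex R)).
rewrite map_char_poly -eigenvalue_root_char; apply/eigenvalueP.
have Punit := spectral_unit AC.
exists (row 0 (spectralmx AC)); last first.
  apply/negP => /eqP P0; have := mulmxV Punit.
  move=> /(congr1 (row 0)); rewrite row_mul P0 mul0mx.
  by move=> /rowP/(_ 0); rewrite !mxE eqxx => /esym/eqP; rewrite oner_eq0.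
rewrite -/AC -row_mul [X in spectralmx AC *m X]specAC !mulmxA mulmxV//.
by rewrite mul1mx row_mul row_diag_mx -scalemxAl -rowE dmu.
Qed.

(** The reflection in the hyperplane orthogonal to [v - e_0] exchanges [e_0]
    and the unit vector [v]. *)
Lemma householder {R : realType} n (v : 'cV[R]_n.+1) :
  v^T *m v = 1%:M ->
  exists H : 'M[R]_n.+1, [/\ H^T = H, H *m H = 1%:M & H *m delta_mx 0 0 = v].
Proof.
move=> vv; pose e : 'cV[R]_n.+1 := delta_mx 0 0.
have ee : e^T *m e = 1%:M.
  by rewrite trmx_delta mul_delta_mx; apply/matrixP=> i j; rewrite !ord1 !mxE.
pose w := v - e; pose s := normF w ^+ 2.
have [/eqP/[!subr_eq0]/eqP ve|w0] := eqVneq w 0.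
  by exists 1%:M; rewrite trmx1 mulmx1 mul1mx ve.
have sE : w^T *m w = s%:M by exact: trmx_mul_cV.
have s0 : s != 0 by rewrite expf_eq0 /= normF_eq0.
have we : w^T *m e = (- (s / 2))%:M.
  have ve_ev : v^T *m e = e^T *m v.
    by rewrite -[LHS]trmxK trmx_mul trmxK [LHS]mx11_scalar mxE -mx11_scalar.
  have : w^T *m w = - (w^T *m e) *+ 2.
    rewrite /w [(v - e)^T]linearB /= !(mulmxBl, mulmxBr) vv ee ve_ev.
    by rewrite !opprB mulr2n.
  rewrite sE => sw; rewrite [LHS]mx11_scalar; congr (_%:M).
  have := congr1 (fun B : 'M_1 => B 0 0) sw; rewrite !mxE eqxx mulr1n /= => ->.
  by field.
exists (1%:M - (2 / s) *: (w *m w^T)); split.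
- by rewrite linearB linearZ /= trmx1 trmx_mul trmxK.
- have WW : w *m w^T *m (w *m w^T) = s *: (w *m w^T).
    by rewrite mulmxA -(mulmxA w) sE mul_mx_scalar -scalemxAl.
  rewrite mulmxBl mul1mx mulmxBr mulmx1 -scalemxAl -scalemxAr WW !scalerA.
  have -> : 2 / s * (2 / s) * s = 2 / s + 2 / s by field.
  by rewrite scalerDl opprB addrK subrK.
- rewrite -/e mulmxBl mul1mx -scalemxAl -mulmxA we mul_mx_scalar scalerA.
  have -> : 2 / s * - (s / 2) = -1 by field.
  by rewrite scaleN1r opprK /w addrC subrK.
Qed.

(** A Householder reflection that maps [e_0] to a unit eigenvector splits off
    a [1 x 1] block; symmetry clears the first row along with the first column.
    The eigenvectors are the rows of [U]. *)
Theorem symmetric_spectral {R : realType} n (A : 'M[R]_n) : A^T = A ->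
  exists (U : 'M[R]_n) (d : 'rV[R]_n),
    U *m U^T = 1%:M /\ A = U^T *m diag_mx d *m U.
Proof.
elim: n A => [|n IHn] A symA.
  by exists 1%:M, 0; split; apply/matrixP => -[].
have [mu /eigenvalueP[x xA x0]] := symmetric_has_eigenvalue symA.
have nx0 : normF x != 0 by rewrite normF_eq0.
pose v := (normF x)^-1 *: x^T.
have xx : x *m x^T = (normF x ^+ 2)%:M.
  by rewrite -{1}[x]trmxK trmx_mul_cV normF_trmx.
have [|H [Ht HH He]] := @householder _ _ v.
  rewrite /v [(_ *: _)^T]linearZ /= trmxK -scalemxAl -scalemxAr scalerA xx.
  by rewrite scale_scalar_mx; congr (_%:M); field.
have Av : A *m v = mu *: v.
  rewrite /v -scalemxAr -[A]symA -trmx_mul xA.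
  by rewrite [(_ *: _)^T]linearZ /= !scalerA mulrC.
(* The size is [1 + n] rather than [n.+1] so that block operations apply. *)
pose B : 'M[R]_(1 + n) := H *m A *m H.
have symB : B^T = B by rewrite /B !trmx_mul Ht symA mulmxA.
have Be : B *m (delta_mx 0 0 : 'cV_n.+1) = mu *: delta_mx 0 0.
  by rewrite /B -!mulmxA He Av -scalemxAr -He mulmxA HH mul1mx.
have AE : A = H *m B *m H.
  by rewrite /B !mulmxA HH mul1mx -mulmxA HH mulmx1.
(* Otherwise [mxE] would expand the product hidden in [B]. *)
clearbody B.
have BE : B = block_mx mu%:M 0 0 (drsubmx B).
  have Bl i : B i 0 = mu * (i == 0)%:R.
    have := congr1 (fun C : 'cV_n.+1 => C i 0) Be.
    by rewrite -colE !mxE andbT.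
  have l0 : lshift n (0 : 'I_1) = 0 by exact/val_inj.
  rewrite -[LHS]submxK; congr block_mx; apply/matrixP => i j.
  - by rewrite !ord1 !mxE l0 Bl !eqxx mulr1.
  - by rewrite -[ursubmx _]trmxK trmx_ursub symB ord1 !mxE l0 Bl mulr0.
  - by rewrite ord1 !mxE l0 Bl mulr0.
have [|V [d [VV BV]]] := IHn (drsubmx B).
  by rewrite trmx_drsub symB.
pose W : 'M[R]_(1 + n) := block_mx 1%:M 0 0 V.
have WW : W *m W^T = 1%:M.
  rewrite tr_block_mx mulmx_block VV !trmx1 !trmx0 !mulmx0 !mul0mx !addr0.
  by rewrite mulmx1 add0r -scalar_mx_block.
have WB : B = W^T *m diag_mx (row_mx mu%:M d) *m W.
  rewrite {1}BE BV diag_mx_row tr_block_mx !mulmx_block.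
  rewrite !trmx1 !trmx0 !mulmx0 !mul0mx !addr0 !mulmx1 !mul1mx !add0r !mul0mx.
  by congr block_mx; apply/matrixP => i j; rewrite !ord1 !mxE.
exists (W *m H), (row_mx mu%:M d); split.
  by rewrite trmx_mul Ht mulmxA -[_ *m H *m H]mulmxA HH mulmx1.
by rewrite AE WB trmx_mul Ht !mulmxA.
Qed.

(** * Extreme eigenvalues, spectral norm and condition number *)

Lemma eigenvalue_spectral {R : realType} n (A U : 'M[R]_n) (d : 'rV[R]_n) mu :
  U *m U^T = 1%:M -> A = U^T *m diag_mx d *m U ->
  eigenvalue A mu <-> exists i, mu = d 0 i.
Proof.
move=> UU AE; have UU' := mulmx1C UU; split=> [/eigenvalueP[v vA v0]|[i ->]].
  have vU0 : v *m U^T != 0.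
    by apply: contra_neq v0 => vU; rewrite -[v]mulmx1 -UU' mulmxA vU mul0mx.
  have [i vi0] : exists i, (v *m U^T) 0 i != 0.
    apply/existsP; apply: contraNT vU0 => /existsPn vU; apply/eqP/rowP => i.
    by rewrite [RHS]mxE; apply/eqP; move: (vU i); rewrite negbK.
  exists i; apply: (mulIf vi0).
  have : v *m U^T *m diag_mx d = mu *: (v *m U^T).
    by rewrite scalemxAl -vA AE -!mulmxA UU mulmx1.
  move=> /rowP/(_ i); rewrite mul_mx_diag [X in X = _]mxE [X in _ = X]mxE => <-.
  exact: mulrC.
apply/eigenvalueP; exists (row i U).
  by rewrite -row_mul AE !mulmxA UU mul1mx row_mul row_diag_mx -scalemxAl -rowE.
apply/negP => /eqP Ui0; have /(congr1 (row i)) := UU.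
rewrite row_mul Ui0 mul0mx => /rowP/(_ i); rewrite !mxE eqxx => /esym/eqP.
by rewrite oner_eq0.
Qed.

(** Infimum and supremum over the spectrum are attained, since they range over
    the finitely many diagonal entries of the spectral decomposition. *)
Lemma symmetric_eigenvalue_extrema {R : realType} n (A : 'M[R]_n.+1) :
  A^T = A ->
  [/\ eigenvalue A (lambda_min A), eigenvalue A (lambda_max A) &
    forall mu, eigenvalue A mu -> lambda_min A <= mu <= lambda_max A].
Proof.
move=> /symmetric_spectral[U [d [UU AE]]].
have eigE mu := eigenvalue_spectral mu UU AE.
pose i := [arg min_(i < ord0) d 0 i]%O; pose j := [arg max_(i > ord0) d 0 i]%O.
have imin k : d 0 i <= d 0 k.
  by rewrite /i; case: arg_minP => // i0 _ /(_ k isT).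
have jmax k : d 0 k <= d 0 j.
  by rewrite /j; case: arg_maxP => // i0 _ /(_ k isT).
have eigi : eigenvalue A (d 0 i) by apply/eigE; exists i.
have eigj : eigenvalue A (d 0 j) by apply/eigE; exists j.
have minE : lambda_min A = d 0 i.
  apply/eqP; rewrite eq_le; apply/andP; split.
    by apply: ge_inf => //; exists (d 0 i) => mu /= /eigE[k ->].
  by apply: lb_le_inf; [exists (d 0 i)|move=> mu /= /eigE[k ->]].
have maxE : lambda_max A = d 0 j.
  apply/eqP; rewrite eq_le; apply/andP; split.
    by apply: ge_sup; [exists (d 0 j)|move=> mu /= /eigE[k ->]].
  by apply: ub_le_sup => //; exists (d 0 j) => mu /= /eigE[k ->].
rewrite minE maxE; split=> // mu /eigE[k ->]; exact/andP.
Qed.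

Lemma quadratic_form_spectral {R : realType} n (A U : 'M[R]_n) (d : 'rV[R]_n)
    (x : 'cV[R]_n) :
  A = U^T *m diag_mx d *m U ->
  (x^T *m A *m x) 0 0 = \sum_i d 0 i * (U *m x) i 0 ^+ 2.
Proof.
move=> ->; rewrite !mulmxA -trmx_mul -mulmxA mul_mx_diag mxE.
by apply: eq_bigr => i _; rewrite !mxE; ring.
Qed.

Lemma rayleigh_ge {R : realType} n (A : 'M[R]_n) (l : R) (x : 'cV[R]_n) :
  A^T = A -> (forall mu, eigenvalue A mu -> l <= mu) ->
  l * normF x ^+ 2 <= (x^T *m A *m x) 0 0.
Proof.
move=> /symmetric_spectral[U [d [UU AE]]] lA.
rewrite (quadratic_form_spectral _ AE) -(normF_orthogonal_mul _ (mulmx1C UU)).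
rewrite sqr_normF mulr_sumr; apply: ler_sum => i _; rewrite big_ord1.
apply: ler_wpM2r; first exact: sqr_ge0.
by apply: lA; apply/(eigenvalue_spectral _ UU AE); exists i.
Qed.

Lemma opnorm2_has_ubound {R : realType} m n (A : 'M[R]_(m, n)) :
  has_ubound
    [set vnorm2 (A *m x) | x in [set x : 'cV[R]_n | vnorm2 x <= 1]]%classic.
Proof.
exists (normF A) => _ [x /= x1 <-]; rewrite !vnorm2E in x1 *.
apply: le_trans (normFM _ _) _; rewrite -[leRHS]mulr1.
by apply: ler_wpM2l => //; exact: normF_ge0.
Qed.

Lemma opnorm2_ge {R : realType} m n (A : 'M[R]_(m, n)) (x : 'cV[R]_n) :
  vnorm2 x <= 1 -> vnorm2 (A *m x) <= opnorm2 A.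
Proof. by move=> x1; apply: (ub_le_sup (opnorm2_has_ubound A)); exists x. Qed.

Lemma opnorm2_ge0 {R : realType} m n (A : 'M[R]_(m, n)) : 0 <= opnorm2 A.
Proof.
by have := opnorm2_ge A (x := 0); rewrite mulmx0 !vnorm2E !normF0; apply.
Qed.

Lemma opnorm2_ge_eigenvector {R : realType} n (A : 'M[R]_n) (mu : R)
    (x : 'cV[R]_n) :
  x != 0 -> A *m x = mu *: x -> `|mu| <= opnorm2 A.
Proof.
rewrite -normF_eq0 => x0 Ax; have nx : normF ((normF x)^-1 *: x) = 1.
  by rewrite normFZ ger0_norm ?invr_ge0 ?normF_ge0// mulVf.
have := @opnorm2_ge _ _ _ A ((normF x)^-1 *: x); rewrite !vnorm2E nx.
by rewrite -scalemxAr Ax scalerA mulrC -scalerA normFZ nx mulr1; apply.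
Qed.

Lemma opnorm2_le {R : realType} n (A : 'M[R]_n) (b : R) :
  A^T = A -> 0 <= b -> (forall mu, eigenvalue A mu -> `|mu| <= b) ->
  opnorm2 A <= b.
Proof.
move=> /symmetric_spectral[U [d [UU AE]]] b0 Ab; have UU' := mulmx1C UU.
apply: ge_sup.
  exists (vnorm2 (A *m 0)); exists 0 => //=.
  by rewrite vnorm2E (eqP (_ : normF 0 == 0)) ?normF_eq0.
move=> _ [x /= x1 <-]; rewrite !vnorm2E in x1 *.
apply: (@le_trans _ _ (b * normF x)); last by nra.
rewrite AE -!mulmxA normF_orthogonal_mul ?trmxK//.
rewrite -(normF_orthogonal_mul x UU').
apply: normF_le; first by rewrite mulr_ge0 ?normF_ge0.
rewrite exprMn sqr_normF mulr_sumr; apply: ler_sum => i _.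
rewrite !big_ord1 mul_diag_mx mxE exprMn; apply: ler_wpM2r; first exact: sqr_ge0.
rewrite -(real_normK (num_real (d 0 i))) ler_pXn2r ?nnegrE//.
by apply: Ab; apply/(eigenvalue_spectral _ UU AE); exists i.
Qed.

(** Eigenvectors of [A] are also eigenvectors of its inverse, so evaluating
    both operator norms on eigenvectors bounds the condition number from
    below. *)
Lemma cond2_ge {R : realType} n (A : 'M[R]_n) (a b : R) :
  A^T = A -> (forall mu, eigenvalue A mu -> 0 < mu) ->
  eigenvalue A a -> eigenvalue A b -> b / a <= cond2 A.
Proof.
move=> symA posA eiga eigb; have [a0 b0] := (posA _ eiga, posA _ eigb).
have Aunit : A \in unitmx.
  rewrite -row_free_unit -kermx_eq0; apply: contraT => kerA.
  suff /posA : eigenvalue A 0 by rewrite ltxx.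
  by rewrite /eigenvalue /eigenspace raddf0 subr0.
have colvec mu : eigenvalue A mu -> exists2 x : 'cV_n, A *m x = mu *: x & x != 0.
  move=> /eigenvalueP[v vA v0]; exists v^T; last by rewrite trmx_eq0.
  by rewrite -[A]symA -trmx_mul vA linearZ.
have [x Ax x0] := colvec _ eigb; have [y Ay y0] := colvec _ eiga.
have bge : b <= opnorm2 A.
  by rewrite -[b](gtr0_norm b0); exact: opnorm2_ge_eigenvector x0 Ax.
have aVge : a^-1 <= opnorm2 (invmx A).
  rewrite -[a^-1]gtr0_norm ?invr_gt0//; apply: (opnorm2_ge_eigenvector y0).
  rewrite -{1}[y](scalerK (lt0r_neq0 a0)) -Ay.
  by rewrite -scalemxAr mulKmx.
by apply: ler_pM => //; rewrite ?invr_ge0 ltW.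
Qed.

Lemma cond2_ge1 {R : realType} n (A : 'M[R]_n.+1) :
  A^T = A -> (forall mu, eigenvalue A mu -> 0 < mu) -> 1 <= cond2 A.
Proof.
move=> symA posA; have [eigA _ _] := symmetric_eigenvalue_extrema symA.
by rewrite -(divff (lt0r_neq0 (posA _ eigA))); exact: cond2_ge.
Qed.

Lemma eigenvalueD_scalar {R : realType} n (A : 'M[R]_n) a mu :
  eigenvalue (A + a%:M) mu = eigenvalue A (mu - a).
Proof.
by rewrite /eigenvalue /eigenspace [(mu - a)%:M]raddfB /= opprB addrA.
Qed.

Lemma opnorm2_le_lambda_max {R : realType} n (A : 'M[R]_n) :
  (0 < n)%N -> A^T = A -> 0 <= lambda_min A -> opnorm2 A <= lambda_max A.
Proof.
case: n A => // n A _ symA min0.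
have [_ maxA extA] := symmetric_eigenvalue_extrema symA.
apply: opnorm2_le => //; first by have := extA _ maxA; lra.
by move=> mu /extA mubd; rewrite ger0_norm; lra.
Qed.

(** * Chebyshev polynomials *)

(** The pair [(T_n t, U_(n-1) t)] of Chebyshev polynomials of the two kinds:
    the coordinates of [(t + sqrt (t ^+ 2 - 1)) ^+ n] on [1] and
    [sqrt (t ^+ 2 - 1)]. Carrying both makes the bound on [[-1, 1]] an algebraic
    consequence of Pell's equation, without trigonometric functions. *)
Fixpoint chebyshev {R : comNzRingType} (t : R) (n : nat) : R * R :=
  if n is k.+1 then
    let TU := chebyshev t k in
    (t * TU.1 + (t ^+ 2 - 1) * TU.2, TU.1 + t * TU.2)
  else (1, 0).

Lemma chebyshev_pell {R : comNzRingType} (t : R) n :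
  (chebyshev t n).1 ^+ 2 - (t ^+ 2 - 1) * (chebyshev t n).2 ^+ 2 = 1.
Proof.
by elim: n => [|n IHn] /=; [|rewrite -[RHS]IHn]; ring.
Qed.

Lemma chebyshev_norm_le1 {R : realFieldType} (t : R) n :
  -1 <= t <= 1 -> `|(chebyshev t n).1| <= 1.
Proof.
move=> t1; have t2 : t ^+ 2 <= 1 by nra.
rewrite -(@ler_pXn2r _ 2) ?nnegrE// real_normK ?num_real// expr1n.
have := chebyshev_pell t n; have := sqr_ge0 (chebyshev t n).2; nra.
Qed.

(** Outside [[-1, 1]], [T_n] grows like a power of [z]: for
    [t = (z + 1/z) / 2] the root [sqrt (t ^+ 2 - 1)] is [(z - 1/z) / 2]. *)
Lemma chebyshev_joukowski {R : realFieldType} (z : R) n : z != 0 ->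
  (chebyshev ((z + z^-1) / 2) n).1 = (z ^+ n + z^-1 ^+ n) / 2.
Proof.
move=> z0; pose t := (z + z^-1) / 2; rewrite -/t.
suff [//] : (chebyshev t n).1 = (z ^+ n + z^-1 ^+ n) / 2 /\
    (z - z^-1) / 2 * (chebyshev t n).2 = (z ^+ n - z^-1 ^+ n) / 2.
have zz : t ^+ 2 - 1 = ((z - z^-1) / 2) ^+ 2 by rewrite /t; field.
elim: n => [|n [IHT IHU]] /=; first by split; rewrite ?expr0 ?mulr0; field.
split.
  by rewrite zz expr2 -[_ * _ * _.2]mulrA IHU IHT /t !exprS; field.
by rewrite mulrDr mulrCA IHU IHT /t !exprS; field.
Qed.

Lemma horner_chebyshev {R : comNzRingType} (p : {poly R}) n x :
  (chebyshev p n).1.[x] = (chebyshev p.[x] n).1.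
Proof.
suff [//] : (chebyshev p n).1.[x] = (chebyshev p.[x] n).1 /\
    (chebyshev p n).2.[x] = (chebyshev p.[x] n).2.
elim: n => [|n [IHT IHU]] /=; first by rewrite !hornerE.
by rewrite !hornerE /= IHT IHU.
Qed.

Lemma size_chebyshev {R : idomainType} (p : {poly R}) n : (size p <= 2)%N ->
  (size (chebyshev p n).1 <= n.+1)%N.
Proof.
move=> p2; suff [//] : (size (chebyshev p n).1 <= n.+1)%N /\
    (size (chebyshev p n).2 <= n)%N.
have sizeM (q r : {poly R}) a b :
    (size q <= a.+1)%N -> (size r <= b)%N -> (size (q * r)%R <= a + b)%N.
  move=> qa rb; apply: leq_trans (size_polyMleq _ _) _.
  by rewrite -subn1 leq_subLR addnA add1n leq_add.
elim: n => [|n [IHT IHU]] /=; first by rewrite size_poly1 size_poly0.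
have pp3 : (size (p ^+ 2 - 1)%R <= 3)%N.
  apply: leq_trans (size_polyD _ _) _; rewrite size_polyN size_poly1 geq_max.
  by rewrite andbT; exact: (sizeM _ _ 1%N 2%N).
split; apply: leq_trans (size_polyD _ _) _; rewrite geq_max; apply/andP; split.
- exact: (sizeM _ _ 1%N n.+1).
- exact: (sizeM _ _ 2%N n).
- by [].
- exact: (sizeM _ _ 1%N n).
Qed.

Lemma chebyshev_rate_ge0 {R : rcfType} (k : R) :
  1 <= k -> 0 <= (Num.sqrt k - 1) / (Num.sqrt k + 1).
Proof.
move=> k1; have s1 : 1 <= Num.sqrt k.
  by rewrite -[X in X <= _]sqrtr1 ler_sqrt // (le_trans ler01).
by rewrite divr_ge0 //; lra.
Qed.

(** The affine image of [T_n] that maps [[l, k l]] to [[-1, 1]], normalized at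
    [0]. The point [0] goes to [(k + 1) / (k - 1) = (z + 1/z) / 2] with
    [z = (sqrt k + 1) / (sqrt k - 1)], so the normalizing value is at least
    [z ^+ n / 2]. *)
Lemma chebyshev_minimax {R : rcfType} (n : nat) (l k : R) : 0 < l -> 1 <= k ->
  exists p : {poly R}, [/\ (size p <= n.+1)%N, p.[0] = 1 &
    forall x, l <= x <= k * l ->
      `|p.[x]| <= 2 * ((Num.sqrt k - 1) / (Num.sqrt k + 1)) ^+ n].
Proof.
move=> l0; rewrite le_eqVlt => /predU1P[<-|k1].
  (* For [k = 1] the interval is the point [l] and the affine map degenerates. *)
  exists ((1 - l^-1 *: 'X) ^+ n); split.
  - apply: leq_trans (size_poly_exp_leq _ _) _; rewrite ltnS.
    rewrite -[leqRHS]mul1n leq_mul2r; apply/orP; right.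
    suff : (size (1 - l^-1 *: 'X)%R <= 2)%N by case: size => // -[|[|]].
    apply: leq_trans (size_polyD _ _) _; rewrite size_poly1 size_polyN.
    rewrite geq_max /=; apply: leq_trans (size_scale_leq _ _) _.
    by rewrite size_polyX.
  - by rewrite !hornerE ?mulr0 ?subr0 ?expr1n.
  - move=> x; rewrite mul1r -eq_le => /eqP <-.
    rewrite !hornerE mulVf ?lt0r_neq0// sqrtr1 subrr mul0r normrX normr0.
    by case: n => [|n]; rewrite ?expr0 ?expr0n ?mulr0//; lra.
pose s := Num.sqrt k; have ks : k = s ^+ 2 by rewrite sqr_sqrtr //; lra.
have s1 : 1 < s by rewrite -[X in X < _]sqrtr1 ltr_sqrt //; lra.
rewrite -/s; pose z := (s + 1) / (s - 1).
have zE : (s - 1) / (s + 1) = z^-1 by rewrite /z; field; rewrite !lt0r_neq0; lra.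
have z0 : 0 < z by rewrite divr_gt0 //; lra.
pose t : {poly R} := ((k + 1) / (k - 1))%:P - (2 / (l * (k - 1))) *: 'X.
have tE x : t.[x] = (k + 1 - 2 * x / l) / (k - 1).
  by rewrite /t !hornerE; field; rewrite !lt0r_neq0; lra.
have t0E : t.[0] = (z + z^-1) / 2.
  by rewrite tE /z ks; field; rewrite !lt0r_neq0; nra.
pose c := (chebyshev t.[0] n).1.
have cE : c = (z ^+ n + z^-1 ^+ n) / 2.
  by rewrite /c t0E chebyshev_joukowski ?lt0r_neq0.
have zn0 : 0 < z ^+ n by rewrite exprn_gt0.
have zVn0 : 0 < z^-1 ^+ n by rewrite exprn_gt0 ?invr_gt0.
have c0 : 0 < c by rewrite cE; lra.
exists (c^-1 *: (chebyshev t n).1); split.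
- apply: leq_trans (size_scale_leq _ _) _; apply: size_chebyshev.
  apply: leq_trans (size_polyD _ _) _; rewrite size_polyN geq_max.
  rewrite (leq_trans (size_polyC_leq1 _)) //=.
  by apply: leq_trans (size_scale_leq _ _) _; rewrite size_polyX.
- by rewrite hornerZ horner_chebyshev mulVf ?lt0r_neq0.
- move=> x /andP[lx xk]; rewrite hornerZ horner_chebyshev normrM.
  rewrite gtr0_norm ?invr_gt0// zE.
  apply: (@le_trans _ _ c^-1).
    rewrite -[leRHS]mulr1; apply: ler_wpM2l; first by rewrite invr_ge0 ltW.
    apply: chebyshev_norm_le1; rewrite tE.
    have xl1 : 1 <= x / l by rewrite ler_pdivlMr ?mul1r.
    have xlk : x / l <= k by rewrite ler_pdivrMr.
    rewrite ler_pdivlMr ?ler_pdivrMr; lra.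
  rewrite -[leRHS]invrK lef_pV2 ?posrE ?invr_gt0 ?mulr_gt0//.
  rewrite invfM exprVn invrK cE exprVn; rewrite exprVn in zVn0; lra.
Qed.

(** * The conjugate gradient residual *)

(** Each multiplication by a Hessenberg matrix moves the support of a vector
    down by at most one row. *)
Lemma hessenberg_krylov {R : realType} n (S : 'M[R]_n.+1) (j : nat) :
  (forall i k : 'I_n.+1, (k.+1 < i)%N -> S i k = 0) ->
  forall i : 'I_n.+1, (j < i)%N -> 
    iter j (mulmx S) (delta_mx 0 0 : 'cV_n.+1) i 0 = 0.
Proof.
move=> hessS; elim: j => [|j IHj] i ji /=.
  by rewrite mxE -(inj_eq val_inj) /= gtn_eqF.
rewrite mxE big1 // => k _; have [kj|jk] := leqP k j.
  by rewrite hessS ?mul0r//; exact: leq_ltn_trans ji.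
by rewrite IHj ?mulr0.
Qed.

(** The conjugate gradient bound for the residual, which is a multiple of the
    last unit vector [e]. As [e^T y = 0], and [e^T S ^+ j e_0 = 0] for [j < n],
    every polynomial [p] of degree at most [n] with [p(0) = 1] satisfies
      [e^T S^-1 p(S) e_0 = e^T S^-1 e_0 = - rho e^T S^-1 e].
    Cauchy-Schwarz for the form [S^-1] bounds the left side by
    [max |p| sqrt (e^T S^-1 e) / sqrt l], and [e^T S^-1 e >= 1 / u]. Working
    with this form, rather than bounding the left side by [max |p| / l], is what
    gives [sqrt (u / l)] in place of [u / l]. The rate refers to [[l, k l]], an
    interval that may be larger than [[l, u]]. *)
Lemma cg_residual_le {R : realType} n (S : 'M[R]_n.+1) (l u k rho : R)
    (y : 'cV[R]_n.+1) :
  S^T = S -> (forall i j : 'I_n.+1, (j.+1 < i)%N -> S i j = 0) ->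
  0 < l -> u <= k * l -> (forall mu, eigenvalue S mu -> l <= mu <= u) ->
  y ord_max 0 = 0 ->
  S *m y = delta_mx 0 0 + rho *: delta_mx ord_max 0 ->
  `|rho| <= 2 * Num.sqrt (u / l) *
    ((Num.sqrt k - 1) / (Num.sqrt k + 1)) ^+ n.
Proof.
move=> /symmetric_spectral[U [d [UU SE]]] hessS l0 ukl specS ymax Sy.
have UU' := mulmx1C UU.
have dlu i : l <= d 0 i <= u.
  by apply: specS; apply/(eigenvalue_spectral _ UU SE); exists i.
have d0 i : 0 < d 0 i by have := dlu i; lra.
have k1 : 1 <= k by have := dlu ord0; nra.
have [p [szp p0 ple]] := chebyshev_minimax n l0 k1.
pose m := 2 * ((Num.sqrt k - 1) / (Num.sqrt k + 1)) ^+ n; rewrite -/m in ple.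
pose a := U *m (delta_mx ord_max 0 : 'cV_n.+1).
pose b := U *m (delta_mx 0 0 : 'cV_n.+1).
have unit_norm i : \sum_j (U *m (delta_mx i 0 : 'cV_n.+1)) j 0 ^+ 2 = 1.
  have := sqr_normF (U *m (delta_mx i 0 : 'cV_n.+1)).
  rewrite normF_orthogonal_mul // normF_delta_cV expr1n => ->.
  by apply: eq_bigr => j _; rewrite big_ord1.
have last_coord (v : 'cV[R]_n.+1) : v ord_max 0 = \sum_i a i 0 * (U *m v) i 0.
  transitivity ((a^T *m (U *m v)) 0 0); last first.
    by rewrite mxE; apply: eq_bigr => i _; rewrite mxE.
  rewrite /a trmx_mul -mulmxA (mulmxA U^T) UU' mul1mx trmx_delta.
  by rewrite -rowE mxE.
have USv (v : 'cV[R]_n.+1) i : (U *m (S *m v)) i 0 = d 0 i * (U *m v) i 0.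
  by rewrite SE !mulmxA UU mul1mx -mulmxA mul_diag_mx mxE.
have moment j : (j < n)%N -> \sum_i a i 0 * b i 0 * d 0 i ^+ j = 0.
  move=> jn; rewrite -[RHS](@hessenberg_krylov _ _ S j hessS ord_max jn).
  rewrite last_coord; apply: eq_bigr => i _; rewrite -mulrA; congr (_ * _).
  elim: j {jn} => [|j IHj] /=; first by rewrite mulr1.
  by rewrite USv -IHj exprS mulrCA.
have ab : \sum_i a i 0 * b i 0 / d 0 i = - rho * \sum_i a i 0 ^+ 2 / d 0 i.
  have Uy i : (U *m y) i 0 = (b i 0 + rho * a i 0) / d 0 i.
    rewrite -[LHS](mulKf (lt0r_neq0 (d0 i))) -USv Sy mulrC; congr (_ / _).
    by rewrite mulmxDr -scalemxAr mxE; congr (_ + _); rewrite mxE.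
  have := last_coord y; rewrite ymax mulr_sumr => /esym/eqP.
  under eq_bigr do rewrite Uy mulrA mulrDr mulrDl.
  rewrite big_split addr_eq0 /= -sumrN => /eqP ->.
  by apply: eq_bigr => i _; ring.
(* [sigma] is [e^T S^-1 e]. *)
pose sigma := \sum_i a i 0 ^+ 2 / d 0 i; rewrite -/sigma in ab.
have pab : \sum_i a i 0 * b i 0 * p.[d 0 i] / d 0 i = - rho * sigma.
  rewrite -ab.
  under eq_bigr => i _.
    rewrite (horner_coef_wide _ szp) big_ord_recl -horner_coef0 p0 expr0 mulr1.
    rewrite mulrDr mulr1 mulrDl mulr_sumr mulr_suml; over.
  rewrite big_split /= exchange_big /= [X in _ + X]big1 ?addr0// => j _.
  transitivity (p`_(lift ord0 j) * \sum_i a i 0 * b i 0 * d 0 i ^+ j).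
    rewrite mulr_sumr; apply: eq_bigr => i _.
    rewrite /bump /= add1n exprS; field; exact: lt0r_neq0.
  by rewrite moment ?mulr0.
have u0 : 0 < u by have := dlu ord0; lra.
have sigma_ge : u^-1 <= sigma.
  rewrite -[u^-1]mul1r -(unit_norm ord_max) mulr_suml.
  apply: ler_sum => i _; apply: ler_wpM2l; first exact: sqr_ge0.
  by rewrite lef_pV2 ?posrE //; have := dlu i; lra.
have m0 : 0 <= m by apply: le_trans (ple l _); [|have := dlu ord0; lra].
have CS : (rho * sigma) ^+ 2 <= sigma * (m ^+ 2 / l).
  rewrite -sqrrN -mulNr -pab.
  have -> : \sum_i a i 0 * b i 0 * p.[d 0 i] / d 0 i =
      \sum_i a i 0 / Num.sqrt (d 0 i) * (b i 0 * p.[d 0 i] / Num.sqrt (d 0 i)).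
    apply: eq_bigr => i _.
    rewrite -[X in _ / X = _](sqr_sqrtr (ltW (d0 i))); field.
    by rewrite lt0r_neq0 ?sqrtr_gt0.
  apply: le_trans (cauchy_schwarz _ _) _.
  have -> : \sum_i (a i 0 / Num.sqrt (d 0 i)) ^+ 2 = sigma.
    by apply: eq_bigr => i _; rewrite expr_div_n sqr_sqrtr ?ltW.
  apply: ler_wpM2l; first by apply: le_trans sigma_ge; rewrite invr_ge0 ltW.
  rewrite -[leRHS]mul1r -(unit_norm ord0) mulr_suml; apply: ler_sum => i _.
  rewrite expr_div_n exprMn (sqr_sqrtr (ltW (d0 i))) -mulrA.
  apply: ler_wpM2l; first exact: sqr_ge0.
  apply: ler_pM; [exact: sqr_ge0|by rewrite invr_ge0 ltW| |].
    rewrite -(real_normK (num_real _)) ler_pXn2r ?nnegrE//.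
    by apply: ple; have := dlu i; lra.
  by rewrite lef_pV2 ?posrE //; have := dlu i; lra.
have sigma0 : 0 < sigma by apply: lt_le_trans sigma_ge; rewrite invr_gt0.
rewrite mulrAC -/m; rewrite -(@ler_pXn2r _ 2) ?nnegrE //; last first.
  by rewrite mulr_ge0 ?sqrtr_ge0.
rewrite real_normK ?num_real// exprMn sqr_sqrtr; last by rewrite divr_ge0 ?ltW.
have -> : m ^+ 2 * (u / l) = m ^+ 2 / l * u by ring.
have ml0 : 0 <= m ^+ 2 / l by rewrite divr_ge0 ?sqr_ge0 ?ltW.
have su : 1 <= sigma * u by rewrite -ler_pdivrMr // div1r.
have rs : rho ^+ 2 * sigma <= m ^+ 2 / l.
  by rewrite -(ler_pM2l sigma0) (le_trans _ CS)// exprMn; lra.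
have := sqr_ge0 rho; nra.
Qed.

(** * Lyapunov equations with a right-hand side of rank one *)

(** In an eigenbasis of [T], the Lyapunov equation decouples into scalar
    equations for the entries of the solution. *)
Lemma lyapunov_spectral {R : realType} n (T X U : 'M[R]_n) (d : 'rV[R]_n)
    (b : 'cV[R]_n) :
  U *m U^T = 1%:M -> T = U^T *m diag_mx d *m U -> (forall i, 0 < d 0 i) ->
  T *m X + X *m T = b *m b^T ->
  forall i j, (U *m X *m U^T) i j =
    (U *m b) i 0 * (U *m b) j 0 / (d 0 i + d 0 j).
Proof.
move=> UU TE d0 lyap i j; pose Y := U *m X *m U^T; rewrite -/Y.
have dij : d 0 i + d 0 j != 0 by rewrite lt0r_neq0 ?addr_gt0.
apply: (mulIf dij); rewrite divfK//.
have : diag_mx d *m Y + Y *m diag_mx d = (U *m b) *m (U *m b)^T.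
  transitivity (U *m (b *m b^T) *m U^T); last by rewrite trmx_mul !mulmxA.
  rewrite -lyap mulmxDr mulmxDl TE /Y.
  congr (_ + _); first by rewrite !mulmxA UU mul1mx.
  by rewrite !mulmxA -(mulmxA _ U U^T) UU mulmx1.
clearbody Y => /matrixP/(_ i j); rewrite mul_diag_mx mul_mx_diag.
rewrite mxE [X in X + _]mxE [X in _ + X]mxE => E.
rewrite [RHS](_ : _ = ((U *m b) *m (U *m b)^T) i j); last first.
  by rewrite [RHS]mxE big_ord1 [_^T _ _]mxE.
by rewrite -E; ring.
Qed.

(** The equation and hence its unique solution are invariant under
    transposition; the entries in the eigenbasis show it. *)
Lemma lyapunov_symmetric {R : realType} n (T X : 'M[R]_n) (b : 'cV[R]_n) :
  T^T = T -> (forall mu, eigenvalue T mu -> 0 < mu) ->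
  T *m X + X *m T = b *m b^T -> X^T = X.
Proof.
move=> /symmetric_spectral[U [d [UU TE]]] posT lyap; have UU' := mulmx1C UU.
have d0 i : 0 < d 0 i.
  by apply: posT; apply/(eigenvalue_spectral _ UU TE); exists i.
pose Y := U *m X *m U^T.
have symY : Y^T = Y.
  apply/matrixP => i j; rewrite mxE !(lyapunov_spectral UU TE d0 lyap).
  by rewrite [d 0 j + _]addrC [(U *m b) j 0 * _]mulrC.
have XE : X = U^T *m Y *m U.
  by rewrite !mulmxA UU' mul1mx -mulmxA UU' mulmx1.
by clearbody Y; rewrite XE !trmx_mul trmxK symY mulmxA.
Qed.

Lemma lyapunov_normF_le {R : realType} n (T X : 'M[R]_n) (b : 'cV[R]_n) l :
  T^T = T -> 0 < l -> (forall mu, eigenvalue T mu -> l <= mu) ->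
  T *m X + X *m T = b *m b^T -> normF X <= normF b ^+ 2 / (2 * l).
Proof.
move=> /symmetric_spectral[U [d [UU TE]]] l0 lT lyap; have UU' := mulmx1C UU.
have ld i : l <= d 0 i.
  by apply: lT; apply/(eigenvalue_spectral _ UU TE); exists i.
have d0 i : 0 < d 0 i by exact: lt_le_trans (ld i).
rewrite -(normF_orthogonal_mul X UU') -(@normF_mul_orthogonal _ _ _ _ U^T);
  last by rewrite trmxK.
rewrite -(normF_orthogonal_mul b UU').
apply: normF_le; first by rewrite divr_ge0 ?sqr_ge0// mulr_ge0 ?ltW.
rewrite expr_div_n sqr_normF; under [X in (X ^+ 2)]eq_bigr do rewrite big_ord1.
rewrite [X in _ <= X / _]expr2 big_distrlr mulr_suml /=; apply: ler_sum => i _.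
rewrite mulr_suml; apply: ler_sum => j _.
rewrite (lyapunov_spectral UU TE d0 lyap) expr_div_n exprMn.
apply: ler_wpM2l; first by rewrite mulr_ge0 ?sqr_ge0.
have [ldi ldj] := (ld i, ld j).
rewrite lef_pV2 ?posrE ?exprn_gt0 ?addr_gt0 ?mulr_gt0//.
by rewrite ler_pXn2r ?nnegrE ?mulr_ge0 ?addr_ge0 ?(ltW (d0 _)) ?(ltW l0)//; lra.
Qed.

(** Along the eigenvectors [u_i] of [T], with eigenvalues [th_i], the solution
    is [X = \sum_i (u_i^T b) y_i u_i^T = \sum_i (u_i^T b) u_i y_i^T] where [y_i]
    solves the system shifted by [th_i]. The second form gives [X e] the
    coordinates [(u_i^T b) (y_i^T e)]. *)
Lemma lyapunov_mul_le {R : realType} n (T X : 'M[R]_n) (b e : 'cV[R]_n) m :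
  T^T = T -> (forall mu, eigenvalue T mu -> 0 < mu) ->
  T *m X + X *m T = b *m b^T -> 0 <= m ->
  (forall th (y : 'cV[R]_n), eigenvalue T th -> T *m y + th *: y = b ->
    `|(e^T *m y) 0 0| <= m) ->
  normF (X *m e) <= normF b * m.
Proof.
move=> /symmetric_spectral[U [d [UU TE]]] posT lyap m0 ym.
have UU' := mulmx1C UU.
have eigd i : eigenvalue T (d 0 i).
  by apply/(eigenvalue_spectral _ UU TE); exists i.
have d0 i : 0 < d 0 i by exact: posT.
rewrite -(normF_orthogonal_mul _ UU') -(normF_orthogonal_mul b UU').
pose y i := U^T *m (\col_j ((U *m b) j 0 / (d 0 j + d 0 i))).
have Uy i : U *m y i = \col_j ((U *m b) j 0 / (d 0 j + d 0 i)).
  by rewrite mulmxA UU mul1mx.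
clearbody y; have ye i : `|(e^T *m y i) 0 0| <= m.
  apply: (ym (d 0 i)) => //.
  rewrite -[LHS]mul1mx -[RHS]mul1mx -UU' -!mulmxA; congr (_ *m _).
  rewrite mulmxDr -scalemxAr TE !mulmxA UU mul1mx -mulmxA Uy mul_diag_mx.
  apply/colP => j; rewrite !mxE -mulrDl mulrC divfK //.
  by rewrite lt0r_neq0 ?addr_gt0.
have UXe i : (U *m (X *m e)) i 0 = (U *m b) i 0 * (e^T *m y i) 0 0.
  have -> : U *m (X *m e) = (U *m X *m U^T) *m (U *m e).
    by rewrite !mulmxA -(mulmxA _ U^T U) UU' mulmx1.
  have -> : e^T *m y i = (U *m e)^T *m (U *m y i).
    by rewrite trmx_mul -mulmxA (mulmxA U^T) UU' mul1mx.
  rewrite Uy mxE [(_^T *m _) 0 0]mxE mulr_sumr; apply: eq_bigr => j _.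
  rewrite (lyapunov_spectral UU TE d0 lyap) [(_^T) 0 j]mxE [(\col_j _) j 0]mxE.
  by rewrite [d 0 j + _]addrC; ring.
apply: normF_le; first by rewrite mulr_ge0 ?normF_ge0.
rewrite exprMn sqr_normF mulr_suml; apply: ler_sum => i _.
rewrite !big_ord1 UXe exprMn; apply: ler_wpM2l; first exact: sqr_ge0.
by rewrite -(real_normK (num_real _)) ler_pXn2r ?nnegrE.
Qed.

(** [G] is the truncation term of the Krylov recurrence and [F] its
    perturbation. *)
Lemma lyapunov_residual_projected {R : realType} N M (A : 'M[R]_N)
    (Q G F : 'M[R]_(N, M)) (T X : 'M[R]_M) (b : 'cV[R]_M) :
  A^T = A -> T^T = T -> X^T = X ->
  A *m Q = Q *m T + G + F -> T *m X + X *m T = b *m b^T ->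
  lyap_residual A (Q *m b) (Q *m X *m Q^T) =
    G *m X *m Q^T + (G *m X *m Q^T)^T + (F *m X *m Q^T + (F *m X *m Q^T)^T).
Proof.
move=> symA symT symX AQ lyap.
have QA : Q^T *m A = T *m Q^T + G^T + F^T.
  by rewrite -{1}symA -trmx_mul AQ !linearD /= trmx_mul symT.
rewrite /lyap_residual trmx_mul !mulmxA -(mulmxA Q b) -lyap.
rewrite -(mulmxA _ Q^T A) QA AQ !trmx_mul !trmxK symX.
rewrite !(mulmxDl, mulmxDr) !mulmxA.
set a1 := Q *m T *m X *m Q^T; set a2 := Q *m X *m T *m Q^T.
set g1 := G *m X *m Q^T; set f1 := F *m X *m Q^T.
set g2 := Q *m X *m G^T; set f2 := Q *m X *m F^T.
by rewrite addrACA (addrACA a1) [LHS]addrC -(addrA (a1 + a2)) addKr.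
Qed.

(** * The Lanczos tridiagonal matrices *)

Lemma lanczosT_symmetric {R : realType} (alpha beta : nat -> R) M :
  (lanczosT alpha beta M)^T = lanczosT alpha beta M.
Proof.
apply/matrixP => i j; rewrite !mxE eq_sym; case: eqP => [->//|_].
by case: eqP => [ji|_]; case: eqP => [ij|_] //; lia.
Qed.

Lemma lanczosT_hessenberg {R : realType} (alpha beta : nat -> R) M
    (i j : 'I_M) : (j.+1 < i)%N -> lanczosT alpha beta M i j = 0.
Proof. by move=> ji; rewrite mxE !ifF //; apply/eqP; lia. Qed.

Definition pad0 {R : realType} n (y : 'cV[R]_n) : 'cV[R]_n.+1 :=
  \col_i (if unlift ord_max i is Some j then y j 0 else 0).

Lemma pad0_lift {R : realType} n (y : 'cV[R]_n) j :
  pad0 y (lift ord_max j) 0 = y j 0.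
Proof. by rewrite mxE liftK. Qed.

Lemma pad0_max {R : realType} n (y : 'cV[R]_n) : pad0 y ord_max 0 = 0.
Proof. by rewrite mxE unlift_none. Qed.

Lemma sum_lift_max {V : nmodType} n (f : 'I_n.+1 -> V) :
  \sum_i f i = \sum_i f (lift ord_max i) + f ord_max.
Proof.
rewrite big_ord_recr; congr (_ + _); apply: eq_bigr => i _; congr f.
by apply/val_inj; rewrite /= /bump leqNgt ltn_ord.
Qed.

Lemma normF_pad0 {R : realType} n (y : 'cV[R]_n) : normF (pad0 y) = normF y.
Proof.
rewrite /normF sum_lift_max big_ord1 pad0_max expr0n addr0; congr Num.sqrt.
by apply: eq_bigr => i _; rewrite !big_ord1 pad0_lift.
Qed.

Lemma pad0_delta {R : realType} n :
  pad0 (delta_mx 0 0 : 'cV[R]_n.+1) = delta_mx 0 0.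
Proof.
apply/colP => i; case: (unliftP ord_max i) => [j|] ->.
  rewrite pad0_lift !mxE; congr (_ && _)%:R.
  by rewrite -!val_eqE /= /bump leqNgt ltn_ord.
by rewrite pad0_max mxE.
Qed.

(** The last Lanczos coefficient is all that couples the new row to the old
    ones, and it sees only the last entry of [y]. *)
Lemma lanczosT_mul_pad0 {R : realType} (alpha beta : nat -> R) m
    (y : 'cV[R]_m.+1) :
  lanczosT alpha beta m.+2 *m pad0 y =
    pad0 (lanczosT alpha beta m.+1 *m y)
    + (beta m.+1 * y ord_max 0) *: delta_mx ord_max 0.
Proof.
have val_lift k (j : 'I_k) : lift ord_max j = j :> nat.
  by rewrite /= /bump leqNgt ltn_ord.
apply/colP => i; rewrite mxE sum_lift_max pad0_max mulr0 addr0 mxE.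
rewrite [X in _ + X]mxE.
case: (unliftP ord_max i) => [k|] ->.
  rewrite pad0_lift [delta_mx _ _ _ _]mxE eq_sym (negPf (neq_lift _ _)) /=.
  rewrite mulr0 addr0 mxE; apply: eq_bigr => j _.
  by rewrite pad0_lift !mxE !val_lift.
rewrite pad0_max add0r [delta_mx _ _ _ _]mxE !eqxx mulr1 (bigD1 ord_max) //=.
rewrite big1 ?addr0 => [|j jmax]; last first.
  rewrite lanczosT_hessenberg ?mul0r // val_lift /=.
  by move: jmax; rewrite -val_eqE /=; have := ltn_ord j; lia.
by rewrite pad0_lift mxE val_lift /= gtn_eqF // gtn_eqF // eqxx.
Qed.

(** One half of Cauchy interlacing: a padded eigenvector has the same Rayleigh
    quotient for the larger matrix. *)
Lemma lanczosT_eigenvalue_ge {R : realType} (alpha beta : nat -> R) m th :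
  eigenvalue (lanczosT alpha beta m.+1) th ->
  lambda_min (lanczosT alpha beta m.+2) <= th.
Proof.
move=> /eigenvalueP[v vT v0].
pose x := v^T; have Tx : lanczosT alpha beta m.+1 *m x = th *: x.
  by rewrite -[lanczosT _ _ _]lanczosT_symmetric -trmx_mul vT linearZ.
have [_ _ minT] :=
  symmetric_eigenvalue_extrema (lanczosT_symmetric alpha beta m.+2).
have x0 : 0 < normF x ^+ 2.
  by rewrite exprn_gt0 // lt0r normF_eq0 trmx_eq0 v0 normF_ge0.
rewrite -(ler_pM2r x0) -{1}normF_pad0.
apply: le_trans (rayleigh_ge _ (lanczosT_symmetric _ _ _) _) _.
  by move=> mu /minT/andP[].
rewrite -mulmxA lanczosT_mul_pad0 Tx mulmxDr -scalemxAr.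
rewrite (_ : pad0 (th *: x) = th *: pad0 x); last first.
  apply/colP => i; rewrite !mxE; case: unlift => [j|]; first by rewrite mxE.
  by rewrite mulr0.
rewrite -scalemxAr trmx_mul_cV normF_pad0 -colE !mxE /=.
by rewrite unlift_none mulr0 addr0 mulr1n.
Qed.

(** For an eigenvalue [th] of [T] and [S = T1 + th], the spectrum of [S] lies in
    [[a + th, b + th]], where [[a, b]] encloses that of [T1]. As [th >= a], its
    condition number is at most [(b + a) / (2 a) <= kappat], which gives the
    rate, and at most [b / a <= cond2 T1], which gives the prefactor. *)
Lemma lanczos_lyapunov_last_column {R : realType} (alpha beta : nat -> R) m
    (X : 'M[R]_m.+1) :
  let T := lanczosT alpha beta m.+1 in
  let T1 := lanczosT alpha beta m.+2 in
  let kappat := cond2 (T1 + (lambda_min T1)%:M) in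
  0 < lambda_min T1 ->
  T *m X + X *m T = delta_mx 0 0 *m (delta_mx 0 0 : 'cV_m.+1)^T ->
  normF (X *m (beta m.+1 *: delta_mx ord_max 0 : 'cV_m.+1)) <=
    2 * Num.sqrt (2 * cond2 T1) *
    ((Num.sqrt kappat - 1) / (Num.sqrt kappat + 1)) ^+ m.+1.
Proof.
move=> T T1 kappat; set a := lambda_min T1 => a0 lyap.
have symT1 : T1^T = T1 by exact: lanczosT_symmetric.
have [eiga eigb extT1] := symmetric_eigenvalue_extrema symT1.
set b := lambda_max T1 in eigb extT1; rewrite -/a in eiga extT1.
have ab : a <= b by have /andP[] := extT1 _ eiga.
have k1 : b / a <= cond2 T1.
  by apply: cond2_ge => // mu /extT1/andP[+ _]; exact: lt_le_trans.
have k2 : (b + a) / (a + a) <= kappat.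
  apply: cond2_ge; rewrite ?eigenvalueD_scalar ?addrK //.
    by rewrite linearD /= symT1 tr_scalar_mx.
  by move=> mu; rewrite eigenvalueD_scalar => /extT1; lra.
have kappat1 : 1 <= kappat.
  by apply: le_trans k2; rewrite ler_pdivlMr ?addr_gt0//; lra.
have r0 : 0 <= ((Num.sqrt kappat - 1) / (Num.sqrt kappat + 1)) ^+ m.+1.
  exact/exprn_ge0/chebyshev_rate_ge0.
set bound := leRHS; rewrite -[bound]mul1r -(normF_delta_cV (0 : 'I_m.+1)).
apply: lyapunov_mul_le lyap _ _; rewrite /bound.
- exact: lanczosT_symmetric.
- by move=> mu /lanczosT_eigenvalue_ge; exact: lt_le_trans.
- by apply: (mulr_ge0 _ r0); rewrite pmulr_rge0 ?sqrtr_ge0.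
move=> th y /lanczosT_eigenvalue_ge; rewrite -/T1 -/a => ath Ty.
have l0 : 0 < a + th by lra.
rewrite linearZ /= -scalemxAl mxE trmx_delta -rowE mxE.
pose S := T1 + th%:M.
have symS : S^T = S by rewrite linearD /= symT1 tr_scalar_mx.
have hessS (i j : 'I_m.+2) : (j.+1 < i)%N -> S i j = 0.
  move=> ji; rewrite mxE lanczosT_hessenberg // mxE add0r.
  by rewrite -val_eqE gtn_eqF //; apply: ltn_trans ji.
have Sy : S *m pad0 y =
    delta_mx 0 0 + (beta m.+1 * y ord_max 0) *: delta_mx ord_max 0.
  rewrite mulmxDl lanczosT_mul_pad0 mul_scalar_mx addrAC -pad0_delta -Ty.
  congr (_ + _); apply/colP => i; rewrite !mxE.
  by case: unlift => [j|]; rewrite ?mxE ?mulr0 ?addr0.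
have ukl : b + th <= kappat * (a + th).
  apply: (@le_trans _ _ ((b + a) / (a + a) * (a + th))); last first.
    by rewrite ler_pM2r.
  by rewrite mulrAC ler_pdivlMr ?addr_gt0//; nra.
apply: le_trans (cg_residual_le symS hessS l0 ukl _ (pad0_max y) Sy) _.
  by move=> mu; rewrite eigenvalueD_scalar => /extT1; lra.
apply: ler_wpM2r => //; apply: ler_wpM2l => //; apply: ler_wsqrtr.
apply: (@le_trans _ _ (b / a)).
  by rewrite ler_pdivrMr // mulrAC ler_pdivlMr //; nra.
by have : 0 <= b / a by [rewrite divr_ge0 //; lra]; lra.
Qed.

(** * The residual in finite precision *)

Lemma unitv_delta {R : realType} n (i : 'I_n) :
  unitv n i.+1 = delta_mx i 0 :> 'cV[R]_n.
Proof. by apply/colP => k; rewrite !mxE eqSS andbT. Qed.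

Lemma normF_lanczos_vector_le {R : realType} N (q : nat -> 'cV[R]_N) M :
  normF (q M.+1) <= normF (lanczosQ q M.+1).
Proof.
have -> : q M.+1 = lanczosQ q M.+1 *m delta_mx ord_max 0.
  by apply/colP => i; rewrite -colE !mxE.
by apply: le_trans (normFM _ _) _; rewrite normF_delta_cV mulr1.
Qed.

Lemma spd_sym {R : realType} n (A : 'M[R]_n) : spd A -> A^T = A.
Proof.
by case=> + _; rewrite is_hermitianmxE expr0 scale1r map_mx_id// => /eqP {2}->.
Qed.

Lemma eps0_ge0 {R : realType} N (eps : R) : 0 < eps -> 0 <= eps0 N eps.
Proof. by move=> e0; rewrite /eps0 !mulr_ge0 ?addr_ge0 ?ler0n// ltW. Qed.

Lemma eps1_ge0 {R : realType} N (A : 'M[R]_N) (eps : R) :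
  0 < eps -> 0 <= eps1 A eps.
Proof.
move=> e0; rewrite /eps1 mulr_ge0 ?(ltW e0)// mulr_ge0// addr_ge0//.
by rewrite mulr_ge0// divr_ge0 ?opnorm2_ge0.
Qed.

Lemma eps2_ge0 {R : realType} N (A : 'M[R]_N) (eps : R) :
  0 < eps -> 0 <= eps2 A eps.
Proof.
move=> e0; apply: mulr_ge0; first exact: sqrtr_ge0.
by rewrite le_max eps1_ge0 ?orbT.
Qed.

Lemma ritz_slack_ge0 {R : realType} N (A : 'M[R]_N) (eps : R) k :
  0 < eps -> 0 <= ritz_slack A eps k.
Proof.
move=> e0; apply: mulr_ge0 (opnorm2_ge0 A).
by apply: mulr_ge0 (eps2_ge0 A e0); exact: powR_ge0.
Qed.

Lemma ritz_slackS {R : realType} N (A : 'M[R]_N) (eps : R) k :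
  0 < eps -> ritz_slack A eps k <= ritz_slack A eps k.+1.
Proof.
move=> e0; apply: ler_wpM2r (opnorm2_ge0 A) _ _ _.
apply: ler_wpM2r (eps2_ge0 A e0) _ _ _.
by apply: ge0_ler_powR; rewrite ?nnegrE ?ler0n ?ler_nat// divr_ge0.
Qed.

Unset Implicit Arguments.
Set Strict Implicit.

Theorem theorem4p1 (R : realType) (N M : nat) (A : 'M[R]_N) (c : 'cV[R]_N)
    (eps : R) (q : nat -> 'cV[R]_N) (alpha beta : nat -> R) (X : 'M[R]_M) :
  (0 < M)%N -> (M < N)%N ->
  spd A -> c != 0 -> 0 < eps ->
  fp_lanczos A c eps M q alpha beta ->
  lambda_min A > M.+1%:R `^ (5 / 2) * eps2 A eps * opnorm2 A ->
  lanczosT alpha beta M *m X + X *m lanczosT alpha beta M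
    = vnorm2 c ^+ 2 *: (unitv M 1 *m (unitv M 1)^T) ->
  let Xlan := lanczosQ q M *m X *m (lanczosQ q M)^T in
  let rho := lyap_residual A c Xlan in
  let T1 := lanczosT alpha beta M.+1 in
  let kappa := cond2 T1 in
  let kappat := cond2 (T1 + (lambda_min T1)%:M) in
  let C1 := (1 + 2 * eps0 N eps) * M.+1%:R * (4 + 4 * Num.sqrt (2 * kappa)) in
  let C2 := Num.sqrt (1 + 2 * eps0 N eps) * M%:R * lambda_max A
            / (lambda_min A - M%:R `^ (5 / 2) * eps2 A eps * opnorm2 A) in
  normF rho / vnorm2 c ^+ 2
    <= C1 * ((Num.sqrt kappat - 1) / (Num.sqrt kappat + 1)) ^+ M
       + C2 * eps1 A eps.
Proof.
case: M X => // m X _ mN /spd_sym symA c0 e0 [_ start [F [AQ Fle]] ritz basis].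
rewrite -/(ritz_slack A eps m.+2) => slack_lt.
set T := lanczosT alpha beta m.+1; set Q := lanczosQ q m.+1 => lyapX.
(* The local definitions sit below the coercion of the inequality to [Prop]. *)
lazy zeta; set rho := lyap_residual A c _.
set T1 := lanczosT alpha beta m.+2; set kappa := cond2 T1.
set kappat := cond2 (T1 + _).
pose s := vnorm2 c ^+ 2; pose e1 : 'cV[R]_m.+1 := delta_mx 0 0.
have s0 : 0 < s by rewrite exprn_gt0 // vnorm2E lt0r normF_eq0 c0 normF_ge0.
have unitv1 : unitv m.+1 1 = e1 by exact: (unitv_delta (0 : 'I_m.+1)).
have unitvM : unitv m.+1 m.+1 = delta_mx ord_max 0 :> 'cV[R]_m.+1.
  exact: (unitv_delta (ord_max : 'I_m.+1)).
(* The solution for the unit right-hand side. *)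
pose Y := s^-1 *: X.
have lyapY : T *m Y + Y *m T = e1 *m e1^T.
  rewrite -scalemxAr -scalemxAl -scalerDr lyapX unitv1 scalerA mulVf ?scale1r//.
  exact: lt0r_neq0.
have symT : T^T = T by exact: lanczosT_symmetric.
pose delta := lambda_min A - ritz_slack A eps m.+1.
have delta0 : 0 < delta.
  by have := @ritz_slackS _ _ A eps m.+1 e0; rewrite /delta; lra.
have deltaT mu : eigenvalue T mu -> delta <= mu.
  by move=> /(ritz m.+1 (or_introl erefl)) /andP[].
have symY : Y^T = Y.
  by apply: lyapunov_symmetric symT _ lyapY => mu /deltaT; exact: lt_le_trans.
pose e := beta m.+1 *: (delta_mx ord_max 0 : 'cV[R]_m.+1).
have AQ' : A *m Q = Q *m T + q m.+2 *m e^T + F.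
  by rewrite AQ unitvM /e [(_ *: _)^T]linearZ /= scalemxAr.
have rhoE : rho = s *: lyap_residual A (Q *m e1) (Q *m Y *m Q^T).
  rewrite /rho /lyap_residual.
  have -> : c *m c^T = s *: (Q *m e1 *m (Q *m e1)^T).
    rewrite start unitv1 -/Q [(_ *: _)^T]linearZ /= -scalemxAl -scalemxAr scalerA.
    by rewrite -expr2.
  have -> : X = s *: Y by rewrite scalerA divff ?scale1r// lt0r_neq0.
  rewrite -(scalemxAr s Q) -(scalemxAl s (Q *m Y)).
  by rewrite -scalemxAr -scalemxAl scalerBr scalerDr.
have nrho : normF rho / s <=
    2 * normF (q m.+2 *m e^T *m Y *m Q^T) + 2 * normF (F *m Y *m Q^T).
  rewrite rhoE normFZ (gtr0_norm s0) mulrC mulrA mulVf ?lt0r_neq0// mul1r.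
  rewrite (lyapunov_residual_projected symA symT symY AQ' lyapY).
  apply: le_trans (normFD _ _) _; rewrite !mulr_natl !mulr2n.
  by apply: lerD; apply: le_trans (normFD _ _) _; rewrite normF_trmx.
apply: le_trans nrho _; pose P := 1 + 2 * eps0 N eps.
have P0 : 0 < P by have := eps0_ge0 N e0; rewrite /P; lra.
have Q1le : normF (lanczosQ q m.+2) <= Num.sqrt (P * m.+2%:R).
  exact: (basis m.+2 (or_intror erefl)).
have Qle : normF Q <= Num.sqrt (P * m.+1%:R).
  exact: (basis m.+1 (or_introl erefl)).
apply: lerD.
(* With [K = sqrt (2 kappa)] the truncation term has the constant [4 K], which
   is below the [4 + 4 K] of [C_1]. *)
- have T1pos : 0 < lambda_min T1.
    have [eigT1 _ _] := symmetric_eigenvalue_extrema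
      (lanczosT_symmetric alpha beta m.+2).
    have /andP[+ _] := ritz m.+2 (or_intror erefl) _ eigT1.
    by apply: lt_le_trans; rewrite subr_gt0.
  have Ye := lanczos_lyapunov_last_column T1pos lyapY.
  rewrite -/e -/T1 -/kappa -/kappat in Ye.
  set r := (_ / _) ^+ m.+1 in Ye *; pose K := Num.sqrt (2 * kappa).
  have Ye0 := normF_ge0 (Y *m e).
  have K0 : 0 <= K by exact: sqrtr_ge0.
  rewrite -/P -/K; rewrite -/K in Ye.
  have -> : q m.+2 *m e^T *m Y *m Q^T = q m.+2 *m (Y *m e)^T *m Q^T.
    by rewrite trmx_mul symY !mulmxA.
  have G1 : normF (q m.+2 *m (Y *m e)^T *m Q^T) <=
      normF (q m.+2) * normF (Y *m e) * normF Q.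
    apply: le_trans (normFM _ _) _; rewrite normF_trmx.
    apply: ler_wpM2r; first exact: normF_ge0.
    by apply: le_trans (normFM _ _) _; rewrite normF_trmx.
  have qle : normF (q m.+2) <= Num.sqrt (P * m.+2%:R).
    exact: le_trans (normF_lanczos_vector_le _ _) Q1le.
  have Qle2 : normF Q <= Num.sqrt (P * m.+2%:R).
    apply: le_trans Qle _; apply: ler_wsqrtr.
    by rewrite ler_pM2l // ler_nat.
  have qQ : normF (q m.+2) * normF Q <= P * m.+2%:R.
    rewrite -[leRHS]sqr_sqrtr ?expr2; last by rewrite mulr_ge0 // ltW.
    by apply: ler_pM => //; exact: normF_ge0.
  have PM0 : 0 <= P * m.+2%:R by rewrite mulr_ge0 // ltW.
  have G2 : normF (q m.+2) * normF Q * normF (Y *m e) <=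
      P * m.+2%:R * (2 * K * r).
    by apply: ler_pM => //; rewrite mulr_ge0 ?normF_ge0.
  have r0 : 0 <= r.
    apply/exprn_ge0/chebyshev_rate_ge0/cond2_ge1.
      by rewrite linearD /= lanczosT_symmetric tr_scalar_mx.
    move=> mu; rewrite eigenvalueD_scalar => eigmu.
    have [_ _ /(_ _ eigmu)/andP[minT1 _]] := symmetric_eigenvalue_extrema
      (lanczosT_symmetric alpha beta m.+2).
    by rewrite -/T1 in minT1; lra.
  have : 0 <= P * m.+2%:R * r by rewrite mulr_ge0.
  nra.
- have FYQ : normF (F *m Y *m Q^T) <= normF F * normF Y * normF Q.
    apply: le_trans (normFM _ _) _; rewrite normF_trmx.
    by apply: ler_wpM2r (normFM _ _); exact: normF_ge0.
  have Yle : normF Y <= (2 * delta)^-1.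
    have := lyapunov_normF_le symT delta0 deltaT lyapY.
    by rewrite normF_delta_cV expr1n div1r.
  have op_le : opnorm2 A <= lambda_max A.
    apply: opnorm2_le_lambda_max => //; first exact: leq_trans mN.
    by have := @ritz_slack_ge0 _ _ A eps m.+2 e0; lra.
  have E0 : 0 <= eps1 A eps by exact: eps1_ge0.
  have Fle' : normF F <= Num.sqrt m.+1%:R * eps1 A eps * lambda_max A.
    apply: le_trans Fle _; apply: ler_wpM2l op_le.
    by rewrite mulr_ge0 ?sqrtr_ge0.
  have prod_le : normF F * normF Y * normF Q <=
      Num.sqrt m.+1%:R * eps1 A eps * lambda_max A * (2 * delta)^-1 *
      Num.sqrt (P * m.+1%:R).
    apply: ler_pM; rewrite ?mulr_ge0 ?normF_ge0//.
    by apply: ler_pM; rewrite ?normF_ge0.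
  rewrite -/P -/(ritz_slack A eps m.+1) -/delta.
  apply: (@le_trans _ _ (2 * (normF F * normF Y * normF Q))).
    by rewrite ler_pM2l.
  apply: le_trans (ler_wpM2l _ prod_le) _ => //.
  rewrite sqrtrM ?(ltW P0)//.
  rewrite -[X in _ <= _ * X * _ / _ * _](sqr_sqrtr (ler0n R m.+1)).
  rewrite le_eqVlt; apply/orP; left; apply/eqP; field; exact: lt0r_neq0.
Qed.
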